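(* There are absolute constants $C,\delta_0>0$ with the following property. Let $A$ be an $m\times n$ binary matrix with $E$ occupied cells, all of which are partitioned into pairs satisfying (C3). If $\epsilon\ge0$, $E/(mn)\ge 2/3-\epsilon$, and \[ \delta=\epsilon+\frac1m+\frac1n\le\delta_0, \] then there are partitions $[m]=R_1\sqcup R_2\sqcup R_3$ of the rows and $[n]=C_1\sqcup C_2\sqcup C_3$ of the columns such that, with $a_i=|R_i|/m$ and $b_i=|C_i|/n$, \[ \operatorname{dist}_{\rm edit}\left(A,\ \overline{\bigcup_{i=1}^3 R_i\times C_i}\right)\le C\delta mn,\qquad \sum_{i=1}^3(a_i-1/3)^2+\sum_{i=1}^3(b_i-1/3)^2\le C\delta. \] In particular, if $m,n\to\infty$ and $E/(mn)\to2/3$, the matrix is within $o(mn)$ cells of such a template (the complement of $\bigcup_i R_i\times C_i$) with all part sizes asymptotic to one third of their respective dimensions.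
   Context: An $m\times n$ binary matrix is identified with its set $O\subseteq[m]\times[n]$ of occupied cells (entries equal to $1$). A pair is an unordered pair of distinct occupied cells $((r,c),(s,d))$; repeated rows ($r=s$) or repeated columns ($c=d$) are allowed. The pairs satisfy (C3) if for each pair $((r,c),(s,d))$ of the partition and all $x\in[m]\setminus\{r,s\}$ and $y\in[n]\setminus\{c,d\}$, at least one of the cells $(x,y),(x,c),(x,d),(r,y),(s,y)$ lies outside $O$. $\overline{X}$ denotes the complement of $X$ in $[m]\times[n]$, regarded as a binary matrix, and $\operatorname{dist}_{\rm edit}$ is the number of cells in which two binary matrices differ. *)

(* Defs.v *)
From mathcomp Require Import all_boot all_order all_algebra.

Set Implicit Arguments.
Unset Strict Implicit.
Unset Printing Implicit Defensive.

(* A binary matrix is identified with its set of occupied cells. *)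
Notation binmx m n := {set 'I_m * 'I_n}.

Section Definitions.
Variables m n : nat.
Implicit Types (O A B : binmx m n) (p q : 'I_m * 'I_n).

(* p = (r, c) and q = (s, d); the cases r = s and c = d are allowed. *)
Definition condC3 O p q : Prop :=
  forall (x : 'I_m) (y : 'I_n),
    x != p.1 -> x != q.1 -> y != p.2 -> y != q.2 ->
    [|| (x, y) \notin O, (x, p.2) \notin O, (x, q.2) \notin O,
        (p.1, y) \notin O | (q.1, y) \notin O].

(* [condC3 O] is symmetric in p and q, so it does not matter in which order
   the two cells of a block are listed. *)
Definition C3_pairing O (P : {set {set 'I_m * 'I_n}}) : Prop :=
  partition P O /\
  forall b : {set 'I_m * 'I_n}, b \in P ->
    exists p q, [/\ p != q, b = [set p; q] & condC3 O p q].

Definition edit_dist A B : nat := #|[set p | (p \in A) != (p \in B)]|.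

Definition template (Rs : 'I_3 -> {set 'I_m}) (Cs : 'I_3 -> {set 'I_n}) :
    binmx m n :=
  ~: \bigcup_(i < 3) setX (Rs i) (Cs i).

End Definitions.

(* Ordered, and possibly with empty parts, unlike [partition]. *)
Definition tripartition (T : finType) (X : 'I_3 -> {set T}) : Prop :=
  (forall i j, i != j -> [disjoint X i & X j]) /\
  \bigcup_(i < 3) X i = [set: T].

(* Main.v *)
Require Import Defs.
From mathcomp Require Import all_boot all_order all_algebra.
From mathcomp Require Import all_classical all_reals all_analysis.
From mathcomp Require Import ring lra.
Import Order.TTheory GRing.Theory Num.Theory.
Import numFieldNormedType.Exports.
Local Open Scope classical_set_scope.
Local Open Scope ring_scope.
Set Implicit Arguments.
Unset Strict Implicit.
Unset Printing Implicit Defensive.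

(** Read the matrix as a bipartite graph between rows and columns, and measure
    everything by averages: alpha(x) is the density of row x, beta(y) that of
    column y, rho the overall density, N(x) the set of occupied columns of row x
    and D(x,r) the density of the intersection of N(x) and N(r).

    The density bound. Fix a row x. If two paired cells (r,c), (s,d) both have
    their column in N(x), then (C3) says that N(r), N(s) and N(x) meet only in
    columns among c and d, so D(x,r) + D(x,s) <= K with K = alpha(x) + 2/n
    [C3_codeg]. Give the cell (r,c), for c in N(x), the weight 1 - K/(2D(x,r)).
    Row r has D(x,r) cells, so its total weight is D(x,r) - K/2; by convexity of
    1/t a pair as above has total weight at most 0; and a single weight never
    exceeds 1/2. Hence only the cells whose partner has its column outside N(x)
    can push the total up, and there are at most rho - E_r D(x,r) of them. This
    gives 3 E_r D(x,r) <= rho + alpha(x) + O(1/m + 1/n) [row_inequality].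
    Averaging over x yields 3 E beta^2 <= 2 rho + O(1/m + 1/n), which forces rho
    <= 2/3 + O(1/m + 1/n) and, when rho >= 2/3 - epsilon, bounds the variance of
    beta around 2/3 by O(delta) [energy_inequality]. The roles of rows and
    columns can be exchanged, so the same holds for alpha.

    Stability. A small bonus in the weight, present only for rows r with D(x,r)
    >= 0.51 K, survives the argument. It shows that on average over x the rows
    that share notably more than half of N(x) contain nearly all of N(x), with a
    total error that is linear in delta. So two typical rows have either almost
    equal or clearly different neighbourhoods. Counting with the nearly constant
    degrees shows that every cluster of nearly equal rows holds between 0.26 m
    and 0.35 m rows [avg_core_ge, avg_near_le]; there are therefore exactly
    three clusters, with centres x0, x1, x2 [three_centers], and they miss only
    O(delta) m rows [avg_uncovered]. If a column is missed by none or by at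
    least two of the centres, its degree is far from 2m/3 [bad_col_cost], so
    there are O(delta) n such columns; all others follow the template exactly in
    the matrix whose rows are replaced by the centres of their clusters
    [template_error].

    Sizes. A column of class i has degree 1 - a_i in the template, so the degree
    variance bounds the b-weighted mean of (a_i - 1/3)^2 by O(delta), and
    symmetrically for the b_i [class_weight_dev]. *)

(** * Averages over finite types *)

Section Averages.
Variable R : realFieldType.
Implicit Types T S : finType.

Definition avg T (f : T -> R) : R := (\sum_t f t) / #|T|%:R.

Lemma avgD T (f g : T -> R) : avg (fun t => f t + g t) = avg f + avg g.
Proof. by rewrite /avg big_split mulrDl. Qed.

Lemma avgN T (f : T -> R) : avg (fun t => - f t) = - avg f.
Proof. by rewrite /avg sumrN mulNr. Qed.

Lemma avgZ T c (f : T -> R) : avg (fun t => c * f t) = c * avg f.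
Proof. by rewrite /avg -mulr_sumr mulrA. Qed.

Lemma avg_cst T c : (0 < #|T|)%N -> avg (fun _ : T => c) = c.
Proof.
move=> T0; rewrite /avg sumr_const -[X in X / _]mulr_natr mulfK //.
by rewrite pnatr_eq0 -lt0n.
Qed.

Lemma eq_avg T (f g : T -> R) : f =1 g -> avg f = avg g.
Proof. by move=> fg; rewrite /avg (eq_bigr g). Qed.

Lemma ler_avg T (f g : T -> R) : (forall t, f t <= g t) -> avg f <= avg g.
Proof. by move=> fg; rewrite ler_wpM2r ?invr_ge0 ?ler0n// ler_sum. Qed.

Lemma avg_ge0 T (f : T -> R) : (forall t, 0 <= f t) -> 0 <= avg f.
Proof. by move=> f0; rewrite mulr_ge0 ?invr_ge0 ?ler0n// sumr_ge0. Qed.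

Lemma exchange_avg T S (f : T -> S -> R) :
  avg (fun t => avg (f t)) = avg (fun s => avg (f^~ s)).
Proof.
by rewrite /avg -!mulr_suml exchange_big/= -!mulrA (mulrC #|S|%:R^-1).
Qed.

Lemma avg_pair T S (f : T * S -> R) :
  avg f = avg (fun t => avg (fun s => f (t, s))).
Proof.
rewrite /avg -mulr_suml pair_big/= card_prod natrM invfM.
rewrite -mulrA (mulrC #|S|%:R^-1); congr (_ * _).
by apply: eq_bigr => -[].
Qed.

Definition point_mass T : R := 1 / #|T|%:R.

Lemma point_mass_ge0 T : 0 <= point_mass T.
Proof. by rewrite divr_ge0// ler0n. Qed.

Lemma avg_eq1 T (t : T) : avg (fun s : T => (s == t)%:R) = point_mass T.
Proof.
rewrite /point_mass /avg (bigD1 t)//= eqxx big1 ?addr0// => s st.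
by rewrite (negbTE st).
Qed.

Lemma avg_inj T (s : T -> T) (f : T -> R) :
  injective s -> avg (fun t => f (s t)) = avg f.
Proof. by move=> s_inj; rewrite /avg [in RHS](reindex_inj s_inj). Qed.

(** An involution lets an inequality that holds on the two-element orbits pass
    to the averages; the orbits will be the paired cells. *)
Lemma ler_avg_invol T (s : T -> T) (f g : T -> R) :
    involutive s -> (forall t, f t + f (s t) <= g t + g (s t)) ->
  avg f <= avg g.
Proof.
move=> sK fg; have /= := ler_avg fg.
rewrite !avgD (avg_inj f (inv_inj sK)) (avg_inj g (inv_inj sK)); lra.
Qed.

(** Second moment method; replacing Cauchy-Schwarz by AM-GM with a free
    parameter [k] avoids square roots. *)
Lemma avg_dev T (k d : R) (w f : T -> R) :
    (0 < #|T|)%N -> 0 < k -> (forall t, 0 <= w t <= 1) ->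
    avg (fun t => f t ^+ 2) <= d ->
  - (1 / k + k * d) <= avg (fun t => w t * f t).
Proof.
move=> T0 k0 w01 fd.
have h t : - (1 / k + k * f t ^+ 2) <= w t * f t.
  have /andP[w0 w1] := w01 t; rewrite -subr_ge0.
  have -> : w t * f t - - (1 / k + k * f t ^+ 2) =
      ((k * f t + w t / 2) ^+ 2 + (1 - w t ^+ 2 / 4)) / k by field; lra.
  by apply: divr_ge0; first apply: addr_ge0; rewrite ?sqr_ge0//; nra.
have := ler_avg h; rewrite avgN avgD avgZ avg_cst//.
have : k * avg (fun t => f t ^+ 2) <= k * d by rewrite ler_pM2l.
lra.
Qed.

End Averages.
Arguments eq_avg {R T f} g.
Arguments avg_cst {R T} c.
Arguments avg_eq1 R {T} t.
Arguments point_mass R T.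
Arguments point_mass_ge0 R T.

(** * Degrees and codegrees *)

Section Degrees.
Variables (R : realFieldType) (I J : finType).
Implicit Types (a : I -> J -> bool) (x r : I).

Definition rdeg a x : R := avg (fun y => (a x y)%:R).
Definition codeg a x r : R := avg (fun y => (a x y && a r y)%:R).

End Degrees.

Definition tr (I J : Type) (a : I -> J -> bool) (y : J) (x : I) := a x y.
Arguments codeg {R I J} a x r.

Section DegreeTheory.
Variables (R : realFieldType) (I J : finType) (a : I -> J -> bool).
Hypotheses (I0 : (0 < #|I|)%N) (J0 : (0 < #|J|)%N).

Local Notation deg := (@rdeg R I J a).
Local Notation cdeg := (@rdeg R J I (tr a)).
Local Notation cod := (@codeg R I J a).

Lemma rdeg_ge0 x : 0 <= deg x.
Proof. by apply: avg_ge0 => y; rewrite ler0n. Qed.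

Lemma codeg_ge0 x r : 0 <= cod x r.
Proof. by apply: avg_ge0 => y; rewrite ler0n. Qed.

Lemma codegC x r : cod x r = cod r x.
Proof. by apply: eq_avg => y; rewrite andbC. Qed.

Lemma codeg_le x r : cod x r <= deg x.
Proof. by apply: ler_avg => y; case: (a x y); case: (a r y). Qed.

Lemma avg_codeg x :
  avg (cod x) = avg (fun y => (a x y)%:R * cdeg y).
Proof.
rewrite exchange_avg; apply: eq_avg => y; rewrite -avgZ.
by apply: eq_avg => r; rewrite /tr -natrM mulnb.
Qed.

Lemma avg_rdeg_tr : avg cdeg = avg deg.
Proof. exact: exchange_avg. Qed.

(** Both sides count the paths with two edges and both ends in the rows. *)
Lemma avg_avg_codeg : avg (fun x => avg (cod x)) = avg (fun y => cdeg y ^+ 2).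
Proof.
under eq_avg do rewrite avg_codeg.
rewrite exchange_avg; apply: eq_avg => y; rewrite expr2 -[in RHS]avgZ.
by apply: eq_avg => x; rewrite mulrC.
Qed.

End DegreeTheory.
Arguments rdeg_ge0 R {I J} a x.
Arguments codeg_ge0 R {I J} a x r.
Arguments codegC R {I J} a x r.
Arguments codeg_le R {I J} a x r.
Arguments avg_rdeg_tr R {I J} a.
Arguments avg_codeg R {I J} a x.
Arguments avg_avg_codeg R {I J} a.

(** * The weight of a cell *)

Section Gain.
Variable R : realFieldType.
Implicit Types K d : R.

(** Weight of an occupied cell (r,c) with c in N(x), where d = D(x,r). The part
    1 - K / (2 d) gives the density bound. The bonus records how far a row with
    d notably above K / 2 is from containing N(x); it is affordable because a
    pair with one such row has weight at most -1/1250 without it. *)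
Definition gain K d : R :=
  1 - K / (2 * d) + (if 51 / 100 * K <= d then (K - d) / K / 1250 else 0).

Lemma gain_half K d : 0 < d -> d <= K -> gain K d <= 1 / 2.
Proof.
move=> d0 dK; rewrite /gain.
have K0 : 0 < K by lra.
have [h|h] := boolP (51 / 100 * K <= d).
  rewrite -subr_ge0.
  have -> : 1 / 2 - (1 - K / (2 * d) + (K - d) / K / 1250) =
    (K - d) * (625 * K - d) / (1250 * d * K) by field; lra.
  apply: divr_ge0; first by apply: mulr_ge0; lra.
  by apply: mulr_ge0; last lra; apply: mulr_ge0; lra.
rewrite -subr_ge0.
have -> : 1 / 2 - (1 - K / (2 * d) + 0) = (K - d) / (2 * d) by field; lra.
by apply: divr_ge0; lra.
Qed.

(** At most one of the two rows gets the bonus. Without it the claim is the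
    inequality between the harmonic and the arithmetic mean. With it, d >= 0.51
    K and e <= K - d, so that K/(2d) + K/(2e) - 2 is at least K^2 / (2 d (K -
    d)) - 2 >= 1/1250, while the bonus is at most 0.49/1250. *)
Lemma gain_pair K d e : 0 < d -> 0 < e -> d + e <= K ->
  gain K d + gain K e <= 0.
Proof.
move=> d0 e0; wlog : d e d0 e0 / e <= d => [hw deK|ed deK].
  have [ed|/ltW de] := leP e d; first exact: hw.
  by rewrite addrC; apply: hw; rewrite // addrC.
have K0 : 0 < K by lra.
rewrite /gain (_ : (51 / 100 * K <= e) = false); last by apply/negbTE; lra.
have [h|h] := boolP (51 / 100 * K <= d); rewrite -oppr_ge0.
  have -> : - (1 - K / (2 * d) + (K - d) / K / 1250 +
      (1 - K / (2 * e) + 0)) =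
    (K * (625 * K * (d + e) - 2500 * d * e) - (K - d) * d * e)
      / (1250 * d * e * K).
    by field; lra.
  have de0 : 0 < d * e by exact: mulr_gt0.
  apply: divr_ge0; last by nra.
  have h1 : (K - d) * (d * e) <= 49 / 100 * K * (d * e).
    by apply: ler_wpM2r; lra.
  have h2 : 0 <= 625 * K * (d + e) - (2500 + 49 / 100) * (d * e).
    have h3 : 0 <= (K - d - e) * (2500 * d - 625 * K).
      by apply: mulr_ge0; lra.
    have h4 : 0 <= (d - 51 / 100 * K) * (d - 49 / 100 * K).
      by apply: mulr_ge0; lra.
    nra.
  have := mulr_ge0 (ltW K0) h2; lra.
have -> : - (1 - K / (2 * d) + 0 + (1 - K / (2 * e) + 0)) =
   (K * (d + e) - 4 * d * e) / (2 * d * e) by field; lra.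
apply: divr_ge0; last by nra.
have : 0 <= (K - d - e) * (d + e) by apply: mulr_ge0; lra.
have := sqr_ge0 (d - e); lra.
Qed.

Lemma gain_row K d : 0 < K -> 0 <= d -> d <= K ->
  d - K / 2 + 51 / 100 / 1250 * (if 51 / 100 * K <= d then K - d else 0)
    <= d * gain K d.
Proof.
move=> K0 d0 dK; rewrite /gain.
have [d1|d1] := ltP 0 d; last first.
  have -> : d = 0 by lra.
  by rewrite mul0r; case: ifP; lra.
have e1 : d * (1 - K / (2 * d)) = d - K / 2 by field; lra.
rewrite mulrDr e1; case: ifPn => [h|_]; last lra.
rewrite lerD2l -subr_ge0.
have -> : d * ((K - d) / K / 1250) - 51 / 100 / 1250 * (K - d) =
   (K - d) * (d - 51 / 100 * K) / (1250 * K) by field; lra.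
apply: divr_ge0; last lra.
by apply: mulr_ge0; lra.
Qed.

End Gain.

(** * The energy inequality *)

Section Energy.
Variables (R : realFieldType) (I J : finType) (a : I -> J -> bool).
Hypotheses (I0 : (0 < #|I|)%N) (J0 : (0 < #|J|)%N).

(** The values of [s] outside the occupied cells are arbitrary. *)
Definition C3_partner (s : I * J -> I * J) : Prop :=
  forall p, a p.1 p.2 ->
    [/\ a (s p).1 (s p).2, s (s p) = p &
        forall x y, x != p.1 -> x != (s p).1 -> y != p.2 -> y != (s p).2 ->
          ~~ [&& a x y, a x p.2, a x (s p).2, a p.1 y & a (s p).1 y]].

Local Notation deg := (@rdeg R I J a).
Local Notation cdeg := (@rdeg R J I (tr a)).
Local Notation cod := (@codeg R I J a).
Local Notation mu := (point_mass R I).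
Local Notation nu := (point_mass R J).

(** Up to a factor, a lower bound for what the bonus of [gain] contributes in
    row r: the part of N(x) that a row sharing over half of it misses. *)
Definition defect (x r : I) : R :=
  let K := deg x + 2 * nu in
  if 51 / 100 * K <= cod x r then K - cod x r else 0.

Variable s : I * J -> I * J.
Hypothesis sP : C3_partner s.

(** Taking x as the free row in (C3), the columns common to N(x) and to the rows
    of both cells of the pair are among the two columns of the pair. *)
Lemma C3_codeg x p : a p.1 p.2 -> x != p.1 -> x != (s p).1 ->
    a x p.2 -> a x (s p).2 ->
  cod x p.1 + cod x (s p).1 <= deg x + 2 * nu.
Proof.
move=> /sP[_ _ c3] xp xq axp axq.
rewrite /codeg -avgD.
have -> : deg x + 2 * nu =
  avg (fun y => (a x y)%:R + ((y == p.2)%:R + (y == (s p).2)%:R)).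
  by rewrite !avgD !avg_eq1 /rdeg; lra.
apply: ler_avg => y; have := c3 x y xp xq; rewrite axp axq.
have [_|_] := eqVneq y p.2; have [_|_] := eqVneq y (s p).2;
  case: (a x y); case: (a p.1 y); case: (a (s p).1 y) => //= c; try lra.
Qed.

(** Double count of the weights of the cells (r,c) with c in N(x). By rows it is
    at least E_r D(x,r) - K/2 plus the bonus. By pairs it is at most half the
    measure of the cells with column outside N(x): a partner of a cell counted
    here either is counted too, and the pair contributes at most 0, or has its
    column outside N(x). The pairs meeting row x itself, for which (C3) says
    nothing, cost at most 1/m. *)
Lemma row_inequality x :
  3 * avg (cod x) + 2 * (51 / 100 / 1250) * avg (defect x)
    <= avg deg + deg x + 2 * mu + 2 * nu.
Proof.
set K := deg x + 2 * nu.
have nu0 : 0 < nu by rewrite divr_gt0 ?ltr01// ltr0n.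
have K0 : 0 < K by have := rdeg_ge0 R a x; rewrite /K; lra.
have codK r : cod x r <= K by have := codeg_le R a x r; rewrite /K; lra.
(* [h] is the weight, [b] the upper bound it is charged to: 1/2 to each cell
   outside the columns of N(x), 1 to each cell of row x. *)
pose h (p : I * J) := (a p.1 p.2 && a x p.2)%:R * gain K (cod x p.1).
pose b (p : I * J) : R :=
  (a p.1 p.2)%:R * (1 / 2 * (1 - (a x p.2)%:R) + (p.1 == x)%:R).
(* Cells outside [a] are fixed by [t], so that [t] is a global involution. *)
pose t p := if a p.1 p.2 then s p else p.
have tK : involutive t.
  move=> p; rewrite /t; case ap: (a p.1 p.2); last by rewrite ap.
  by have [-> -> _] := sP ap.
have hE : avg h = avg (fun r => cod x r * gain K (cod x r)).
  rewrite avg_pair; apply: eq_avg => r; rewrite mulrC -avgZ.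
  by apply: eq_avg => y; rewrite /h/= mulrC andbC.
have bE : avg b <= 1 / 2 * (avg deg - avg (cod x)) + mu.
  rewrite avg_pair -(avg_eq1 R x) -avgN -avgD -avgZ -avgD.
  apply: ler_avg => r; rewrite /rdeg /codeg -avgN -avgD -avgZ.
  rewrite -[X in _ + X](avg_cst _ J0) -avgD; apply: ler_avg => y.
  by rewrite /b/=; case: (a r y); case: (a x y); case: (r == x) => /=; lra.
have pos r y : a r y -> a x y -> 0 < cod x r.
  move=> ary axy; apply: (lt_le_trans nu0).
  rewrite -(avg_eq1 R y); apply: ler_avg => z.
  by case: eqP => [->|_]; rewrite ?ary ?axy ?ler0n.
have hb : avg h <= avg b.
  apply: (ler_avg_invol tK) => p; rewrite /t.
  case: ifPn => [ap|/negbTE ap]; last by rewrite /h /b ap !mul0r.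
  have [aq _ _] := sP ap; rewrite /h /b ap aq /= !mul1r.
  have [axp|axp] := boolP (a x p.2); have [axq|axq] := boolP (a x (s p).2);
    rewrite /= ?mul1r ?mul0r.
  - have gp := gain_half (pos _ _ ap axp) (codK p.1).
    have gq := gain_half (pos _ _ aq axq) (codK (s p).1).
    have [_|xp] := eqVneq p.1 x; first by case: (_ == _) => /=; lra.
    have [_|xq] := eqVneq (s p).1 x; first by rewrite /=; lra.
    have := C3_codeg ap _ _ axp axq; rewrite ![x == _]eq_sym xp xq.
    move=> /(_ isT isT) /(gain_pair (pos _ _ ap axp) (pos _ _ aq axq)).
    by rewrite /=; lra.
  - have gp := gain_half (pos _ _ ap axp) (codK p.1).
    by case: (_ == _); case: (_ == _) => /=; lra.
  - have gq := gain_half (pos _ _ aq axq) (codK (s p).1).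
    by case: (_ == _); case: (_ == _) => /=; lra.
  - by case: (_ == _); case: (_ == _) => /=; lra.
have : avg (cod x) - K / 2 + 51 / 100 / 1250 * avg (defect x) <= avg h.
  rewrite hE -avgZ -[X in _ - X + _](avg_cst _ I0) -avgN -!avgD.
  by apply: ler_avg => r; apply: gain_row => //; apply: codeg_ge0.
rewrite /K in hb bE *; lra.
Qed.

(** Average of [row_inequality] over x. The left side becomes 3 E beta^2 and the
    right side 2 rho; completing the square around 2/3 turns this into a bound
    on the variance in terms of 2/3 - rho. *)
Lemma energy_inequality :
  avg (fun y => (cdeg y - 2 / 3) ^+ 2) +
      2 / 3 * (51 / 100 / 1250) * avg (fun x => avg (defect x))
    <= 2 / 3 * (2 / 3 - avg deg + mu + nu).
Proof.
have := ler_avg row_inequality.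
rewrite !avgD !(avg_cst (2 * _))// (avg_cst (avg deg))// !avgZ.
rewrite (avg_avg_codeg R a).
have -> : avg (fun y => (cdeg y - 2 / 3) ^+ 2) =
    avg (fun y => cdeg y ^+ 2) - 4 / 3 * avg deg + 4 / 9.
  rewrite -(avg_rdeg_tr R a) -[4 / 9](avg_cst _ J0) -avgZ -avgN -!avgD.
  by apply: eq_avg => y; field.
lra.
Qed.

End Energy.

(** * Sizes of the parts of a template *)

Section Sizes.
Variables (R : realFieldType) (I J : finType) (a : I -> J -> bool).
Variables (f : I -> 'I_3) (g : J -> 'I_3) (e d : R).
Hypotheses (I0 : (0 < #|I|)%N) (J0 : (0 < #|J|)%N).

Definition class_weight (T : finType) (h : T -> 'I_3) (i : 'I_3) : R :=
  avg (fun t => (h t == i)%:R).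

Lemma avg_class (T : finType) (h : T -> 'I_3) (F : 'I_3 -> R) :
  avg (fun t => F (h t)) = \sum_i class_weight h i * F i.
Proof.
rewrite /class_weight /avg; under [RHS]eq_bigr do rewrite mulrAC mulr_suml.
rewrite -mulr_suml exchange_big /=; congr (_ / _); apply: eq_bigr => t _.
rewrite (bigD1 (h t))//= eqxx mul1r big1 ?addr0// => i it.
by rewrite eq_sym (negbTE it) mul0r.
Qed.

(** In the template a column of class i has density 1 - a_i, so each column of
    the matrix differs from this by at most its number of errors. *)
Lemma class_weight_dev :
    avg (fun y => (rdeg R (tr a) y - 2 / 3) ^+ 2) <= e ->
    avg (fun r => avg (fun y => (a r y (+) (f r != g y))%:R)) <= d ->
  \sum_i class_weight g i * (class_weight f i - 1 / 3) ^+ 2 <= 2 * d + 2 * e.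
Proof.
move=> he; rewrite exchange_avg => hd.
rewrite -(avg_class g (fun i => (class_weight f i - 1 / 3) ^+ 2)).
pose err y : R := avg (fun r => (a r y (+) (f r != g y))%:R).
suff h y : (class_weight f (g y) - 1 / 3) ^+ 2 <=
    2 * err y + 2 * (rdeg R (tr a) y - 2 / 3) ^+ 2.
  by have := ler_avg h; rewrite avgD !avgZ; rewrite /err; lra.
have err0 : 0 <= err y by apply: avg_ge0 => r; rewrite ler0n.
have err1 : err y <= 1.
  by rewrite -[leRHS](avg_cst 1 I0); apply: ler_avg => r; rewrite lern1 leq_b1.
have h1 : 1 - class_weight f (g y) <= rdeg R (tr a) y + err y.
  rewrite -[X in X - _](avg_cst 1 I0) -avgN -!avgD; apply: ler_avg => r.
  by rewrite /tr; case: (a r y); case: (f r == g y) => /=; lra.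
have h2 : rdeg R (tr a) y <= 1 - class_weight f (g y) + err y.
  rewrite -[X in X - _ + _](avg_cst 1 I0) -avgN -!avgD; apply: ler_avg => r.
  by rewrite /tr; case: (a r y); case: (f r == g y) => /=; lra.
set t := rdeg R (tr a) y in h1 h2 *; set w := class_weight f (g y) in h1 h2 *.
have : (1 - w - t) ^+ 2 <= err y.
  have : 0 <= (err y - (1 - w - t)) * (err y + (1 - w - t)).
    by apply: mulr_ge0; lra.
  have : 0 <= err y * (1 - err y) by apply: mulr_ge0; lra.
  lra.
have := sqr_ge0 ((1 - w - t) - (t - 2 / 3)); lra.
Qed.

End Sizes.

(** * From energy to clusters of rows *)

Section Clusters.
Variables (R : realFieldType) (I J : finType) (a : I -> J -> bool) (e : R).
Hypotheses (I0 : (0 < #|I|)%N) (J0 : (0 < #|J|)%N).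

Local Notation deg := (@rdeg R I J a).
Local Notation cdeg := (@rdeg R J I (tr a)).
Local Notation cod := (@codeg R I J a).
Local Notation nu := (point_mass R J).

Hypotheses (e0 : 0 <= e) (e_small : e <= 1 / 1000 / 1000 / 1000 / 1000).
Hypothesis nu_small : nu <= e.
Hypothesis cdegV : avg (fun y => (cdeg y - 2 / 3) ^+ 2) <= e.
Hypothesis degV : avg (fun x => (deg x - 2 / 3) ^+ 2) <= e.
Hypothesis defectV : avg (fun x => avg (defect R a x)) <= e.

Definition hamming x r : R := avg (fun y => (a x y (+) a r y)%:R).

Definition regular x := `|deg x - 2 / 3| <= 1 / 200.

(** In the template rows of different classes have codegree 1/3, rows of the
    same class 2/3. The threshold lies just above 1/3 so that the classes
    defined by it are provably larger than 1/4 [avg_near_ge], which excludes a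
    fourth one. *)
Definition near x r := [&& regular x, regular r & 7 / 20 <= cod x r].

(** Unlike [near], this relation is so tight that cores of rows that are not
    [near] are disjoint [core_disjoint]. *)
Definition core x r := [&& regular x, regular r & hamming x r <= 1 / 10].

Definition scatter x : R := avg (fun r => (near x r)%:R * hamming x r).

Definition good x := regular x && (scatter x <= 1 / 100 / 100).

Lemma hammingE x r : hamming x r = deg x + deg r - 2 * cod x r.
Proof.
rewrite /hamming -avgZ -avgN -!avgD; apply: eq_avg => y.
by case: (a x y); case: (a r y) => /=; lra.
Qed.

Lemma hamming_ge0 x r : 0 <= hamming x r.
Proof. by apply: avg_ge0 => y; rewrite ler0n. Qed.

Lemma hammingC x r : hamming x r = hamming r x.
Proof. by apply: eq_avg => y; rewrite addbC. Qed.

Lemma hamming_le1 x r : hamming x r <= 1.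
Proof.
rewrite -(avg_cst 1 J0); by apply: ler_avg => y; rewrite lern1 leq_b1.
Qed.

Lemma hamming_triangle r x z : hamming x z <= hamming x r + hamming z r.
Proof.
rewrite -avgD; apply: ler_avg => y.
by case: (a x y); case: (a r y); case: (a z y) => /=; lra.
Qed.

Lemma regularP x :
  reflect (2 / 3 - 1 / 200 <= deg x /\ deg x <= 2 / 3 + 1 / 200) (regular x).
Proof.
rewrite /regular ler_norml; apply: (iffP andP) => -[h1 h2]; split; lra.
Qed.

Lemma scatter_ge0 x : 0 <= scatter x.
Proof.
by apply: avg_ge0 => r; rewrite mulr_ge0 ?hamming_ge0// ler0n.
Qed.

Lemma nearC x r : near x r = near r x.
Proof. by rewrite /near codegC; case: (regular x); case: (regular r). Qed.

Lemma defect_ge0 x r : 0 <= defect R a x r.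
Proof.
rewrite /defect; case: ifP => // _; have := codeg_le R a x r.
have : 0 <= nu by exact: point_mass_ge0.
lra.
Qed.

(** The two defects are the parts of N(x) and of N(r) outside the intersection;
    regularity makes 7/20 exceed 0.51 K for both rows. *)
Lemma near_defect x r : near x r ->
  hamming x r <= defect R a x r + defect R a r x.
Proof.
have e_small' := e_small.
have nu_small' := nu_small.
move=> /and3P[/regularP[? ?] /regularP[? ?] h]; rewrite hammingE /defect.
have nu0 : 0 <= nu by exact: point_mass_ge0.
rewrite (codegC R a r x) !ifT; lra.
Qed.

Lemma avg_scatter : avg scatter <= 2 * e.
Proof.
have defectV' := defectV.
suff : avg scatter <= avg (fun x => avg (defect R a x)) +
    avg (fun r => avg (defect R a r)) by lra.
rewrite [X in _ + X]exchange_avg -avgD; apply: ler_avg => x.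
rewrite -avgD; apply: ler_avg => r; have [/near_defect|_] := boolP (near x r).
  by rewrite mul1r.
by rewrite mul0r addr_ge0 ?defect_ge0.
Qed.

Lemma avg_irregular : avg (fun x => (~~ regular x)%:R) <= 200 * 200 * e.
Proof.
have degV' := degV.
have h x : (~~ regular x)%:R <= 200 * 200 * (deg x - 2 / 3) ^+ 2.
  have [_|xR] := boolP (regular x) => /=.
    by rewrite mulr_ge0 ?sqr_ge0 ?ler0n.
  rewrite -(real_normK (num_real _)).
  by move: xR; rewrite /regular -ltNge; nra.
by have := ler_avg h; rewrite avgZ; lra.
Qed.

Lemma avg_not_good : avg (fun x => (~~ good x)%:R) <= 300 * 200 * e.
Proof.
have h x : (~~ good x)%:R <= (~~ regular x)%:R + 100 * 100 * scatter x.
  rewrite /good; have := scatter_ge0 x; case: (regular x) => /=; last lra.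
  by case: (leP (scatter x)) => /=; lra.
have := ler_avg h; rewrite avgD avgZ.
have := avg_irregular; have := avg_scatter; lra.
Qed.

Lemma core_near x r : core x r -> near x r.
Proof.
move=> /and3P[xR rR]; rewrite hammingE /near xR rR /= => h.
move: xR rR => /regularP[? ?] /regularP[? ?]; lra.
Qed.

(** Markov's inequality: the rows of the cluster outside the core contribute at
    least 1/10 each to the scatter. *)
Lemma avg_near_core x :
  avg (fun r => (near x r && ~~ core x r)%:R) <= 10 * scatter x.
Proof.
rewrite -avgZ; apply: ler_avg => r.
have := hamming_ge0 x r; have [/and3P[xR rR _]|_] := boolP (near x r) => /=.
  by rewrite /core xR rR /=; case: (leP (hamming x r)) => /=; lra.
by lra.
Qed.

Lemma core_disjoint x z r : core x r -> core z r -> near x z.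
Proof.
move=> /and3P[xR _ xr] /and3P[zR _ zr]; rewrite /near xR zR /=.
have := hamming_triangle r x z; rewrite hammingE.
move: xR zR => /regularP[? ?] /regularP[? ?]; lra.
Qed.

(** Count the paths from x to r through N(x). As column degrees are nearly 2/3,
    the average codegree is about 4/9; rows outside the cluster only account for
    7/20, so the cluster must supply the rest. *)
Lemma avg_near_ge x : good x -> 27 / 100 <= avg (fun r => (near x r)%:R) :> R.
Proof.
move=> /andP[xR _].
have h r : cod x r <=
    (7 / 20 + (~~ regular r)%:R) + 13 / 40 * (near x r)%:R.
  have := codeg_le R a x r; have := codeg_ge0 R a x r.
  have := xR => /regularP[_ ?].
  rewrite /near xR /=; case: (regular r) => /=; last lra.
  by case: (leP (7 / 20) (cod x r)) => /=; lra.
have := ler_avg h; rewrite !avgD (avgZ (13 / 40)) avg_cst// avg_codeg.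
have -> : avg (fun y => (a x y)%:R * cdeg y) =
    2 / 3 * deg x + avg (fun y => (a x y)%:R * (cdeg y - 2 / 3)).
  rewrite /rdeg -avgZ -avgD; apply: eq_avg => y; lra.
have e0' := e0; have e_small' := e_small.
have e1 : 0 < 1000 :> R by lra.
have w01 y : 0 <= ((a x y)%:R : R) <= 1.
  by case: (a x y); rewrite /= ?lexx ?ler01.
have := avg_dev J0 e1 w01 cdegV.
have := avg_irregular; move: xR => /regularP[xR _] irr.
lra.
Qed.

Lemma avg_core_ge x : good x -> 26 / 100 <= avg (fun r => (core x r)%:R) :> R.
Proof.
move=> gx; have := avg_near_ge gx; have := avg_near_core x.
move: gx => /andP[_ sx].
suff : avg (fun r => (near x r)%:R) <= avg (fun r => (core x r)%:R) +
   avg (fun r => (near x r && ~~ core x r)%:R) :> R by lra.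
rewrite -avgD; apply: ler_avg => r.
by case: (near x r); case: (core x r) => /=; lra.
Qed.

(** The columns outside N(x) are missed by almost all rows of the cluster, yet
    their degrees are nearly 2/3; so the cluster is hardly larger than 1/3. *)
Lemma avg_near_le x : good x -> avg (fun r => (near x r)%:R) <= 35 / 100 :> R.
Proof.
move=> /andP[xR sx].
have D : 1 - deg x = avg (fun y => (~~ a x y)%:R).
  rewrite /rdeg -{1}(avg_cst 1 J0) -avgN -avgD.
  by apply: eq_avg => y; case: (a x y) => /=; lra.
have h r : (1 - deg x) * (near x r)%:R +
    avg (fun y => (~~ a x y)%:R * (a r y)%:R)
   <= (1 - deg x) + (near x r)%:R * hamming x r.
  rewrite D -avgZ mulrC -avgZ -!avgD; apply: ler_avg => y.
  by case: (near x r); case: (a x y); case: (a r y) => /=; lra.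
have := ler_avg h; rewrite !avgD (avgZ (1 - deg x)) avgN !avg_cst//.
rewrite (exchange_avg (fun r y => (~~ a x y)%:R * (a r y)%:R)).
have -> : avg (fun y => avg (fun r => (~~ a x y)%:R * (a r y)%:R)) =
   2 / 3 * (1 - deg x) + avg (fun y => (~~ a x y)%:R * (cdeg y - 2 / 3)).
  rewrite D -avgZ -avgD; apply: eq_avg => y; rewrite avgZ /rdeg /tr.
  by lra.
have e0' := e0; have e_small' := e_small.
have e1 : 0 < 1000 :> R by lra.
have w01 y : 0 <= ((~~ a x y)%:R : R) <= 1.
  by case: (a x y); rewrite /= ?lexx ?ler01.
have := avg_dev J0 e1 w01 cdegV.
move: xR sx => /regularP[xR1 xR2]; rewrite /scatter.
set N := avg (fun r => (near x r)%:R) => sx dev le1.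
rewrite leNgt; apply/negP => N35.
have : 0 <= (N - 35 / 100) * (1 - deg x) by apply: mulr_ge0; lra.
lra.
Qed.

(** Only the average of the scatter is linear in e, so the centres have to be
    chosen well: a minimiser over a set of positive density is at most the
    average over that set. *)
Lemma small_scatter (B : pred I) : 1 / 4 <= avg (fun x => (B x)%:R) :> R ->
  exists2 x, B x & scatter x <= 8 * e.
Proof.
move=> B4.
have [x0 Bx0|B0] := pickP B; last first.
  move: B4; rewrite (eq_avg (fun=> 0)); last by move=> x; rewrite B0.
  by rewrite avg_cst//; lra.
have [x Bx xmin] := @arg_minP _ R I x0 B scatter Bx0.
exists x => //; have h y : scatter x * (B y)%:R <= scatter y.
  have := scatter_ge0 y; have [/xmin|_] := boolP (B y) => /=; lra.
have := ler_avg h; rewrite avgZ.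
have := avg_scatter; have := scatter_ge0 x; nra.
Qed.

(** Greedy choice: two clusters take at most 70 percent of the rows, so there is
    room for a third centre outside them. *)
Lemma three_centers : exists x0 x1 x2,
  [/\ [/\ good x0, good x1 & good x2],
      [/\ scatter x0 <= 8 * e, scatter x1 <= 8 * e & scatter x2 <= 8 * e] &
      [/\ ~~ near x0 x1, ~~ near x0 x2 & ~~ near x1 x2]].
Proof.
have ng : avg (fun x => (~~ good x)%:R) <= 1 / 100 :> R.
  by have := avg_not_good; have := e_small; lra.
have [|x0 g0 s0] := @small_scatter good.
  suff : 1 - avg (fun x => (~~ good x)%:R) <= avg (fun x => (good x)%:R) :> R
    by lra.
  rewrite -{1}(avg_cst 1 I0) -avgN -avgD; apply: ler_avg => x.
  by case: (good x) => /=; lra.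
have n0 := avg_near_le g0.
have [|x1 /andP[g1 n01] s1] := @small_scatter (fun x => good x && ~~ near x0 x).
  suff : 1 - avg (fun x => (~~ good x)%:R) - avg (fun x => (near x0 x)%:R)
     <= avg (fun x => (good x && ~~ near x0 x)%:R) :> R by lra.
  rewrite -{1}(avg_cst 1 I0) -!avgN -!avgD; apply: ler_avg => x.
  by case: (good x); case: (near x0 x) => /=; lra.
have n1 := avg_near_le g1.
have [|x2 /and3P[g2 n02 n12] s2] :=
    @small_scatter (fun x => [&& good x, ~~ near x0 x & ~~ near x1 x]).
  suff : 1 - avg (fun x => (~~ good x)%:R) - avg (fun x => (near x0 x)%:R)
       - avg (fun x => (near x1 x)%:R)
     <= avg (fun x => [&& good x, ~~ near x0 x & ~~ near x1 x]%:R) :> R by lra.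
  rewrite -{1}(avg_cst 1 I0) -!avgN -!avgD; apply: ler_avg => x.
  by case: (good x); case: (near x0 x); case: (near x1 x) => /=; lra.
by exists x0, x1, x2.
Qed.

Section Template.
Variables x0 x1 x2 : I.
Hypotheses (g0 : good x0) (g1 : good x1) (g2 : good x2).
Hypotheses (s0 : scatter x0 <= 8 * e) (s1 : scatter x1 <= 8 * e).
Hypothesis s2 : scatter x2 <= 8 * e.
Hypotheses (n01 : ~~ near x0 x1) (n02 : ~~ near x0 x2) (n12 : ~~ near x1 x2).

Lemma core_excl x z r : ~~ near x z -> core x r -> core z r = false.
Proof.
by move=> n xr; apply/negP => zr; move: n; rewrite (core_disjoint xr zr).
Qed.

(** Otherwise the cores of x0, x1, x2, z would be four disjoint sets of density
    at least 0.26 each. *)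
Lemma good_covered z : good z -> [|| near x0 z, near x1 z | near x2 z].
Proof.
move=> gz; apply/negPn/negP; rewrite !negb_or => /and3P[n0 n1 n2].
have : avg (fun r => (core x0 r)%:R) + avg (fun r => (core x1 r)%:R) +
    avg (fun r => (core x2 r)%:R) + avg (fun r => (core z r)%:R) <= 1 :> R.
  rewrite -!avgD -[leRHS](avg_cst 1 I0); apply: ler_avg => r.
  have [c0|_] := boolP (core x0 r).
    rewrite (core_excl n01 c0) (core_excl n02 c0) (core_excl n0 c0) /=; lra.
  have [c1|_] := boolP (core x1 r).
    rewrite (core_excl n12 c1) (core_excl n1 c1) /=; lra.
  have [c2|_] := boolP (core x2 r); first by rewrite (core_excl n2 c2) /=; lra.
  by case: (core z r) => /=; lra.
have := avg_core_ge g0; have := avg_core_ge g1.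
have := avg_core_ge g2; have := avg_core_ge gz; lra.
Qed.

(** The third class of rows absorbs the rows outside all cores, and the third
    class of columns those that both x0 and x1 meet, so that both are exact
    partitions. *)
Definition row_class r : 'I_3 :=
  if core x0 r then inord 0 else if core x1 r then inord 1 else inord 2.

Definition col_class y : 'I_3 :=
  if ~~ a x0 y then inord 0 else if ~~ a x1 y then inord 1 else inord 2.

Definition center r : I :=
  if core x0 r then x0 else if core x1 r then x1 else x2.

Lemma inord3_eq (i j : nat) : (i < 3)%N -> (j < 3)%N ->
  (inord i == inord j :> 'I_3) = (i == j).
Proof. by move=> i3 j3; rewrite -val_eqE /= !inordK. Qed.

Definition inord3E := (inord3_eq, eqxx).

Lemma avg_uncovered :
  avg (fun r => (~~ [|| core x0 r, core x1 r | core x2 r])%:R)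
    <= 300 * 300 * e.
Proof.
have h r : (~~ [|| core x0 r, core x1 r | core x2 r])%:R <=
    (~~ good r)%:R + (near x0 r && ~~ core x0 r)%:R
      + (near x1 r && ~~ core x1 r)%:R + (near x2 r && ~~ core x2 r)%:R :> R.
  have := @good_covered r; case: (good r) => [/(_ isT)|_].
    case: (near x0 r); case: (near x1 r); case: (near x2 r) => // _;
    case: (core x0 r); case: (core x1 r); case: (core x2 r) => /=; lra.
  rewrite -!natrD ler_nat addnAC -addnA -addnA.
  by apply: leq_trans (leq_b1 _) (leq_addr _ _).
have := ler_avg h; rewrite !avgD.
have := avg_near_core x0; have := avg_near_core x1.
have := avg_near_core x2; have := avg_not_good.
have := e0; have := s0; have := s1; have := s2; lra.
Qed.

Definition row_error y : R := avg (fun r => (a r y (+) a (center r) y)%:R).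

Lemma avg_row_error : avg row_error <= 350 * 350 * e.
Proof.
have h r : hamming r (center r) <= (near x0 r)%:R * hamming x0 r
   + (near x1 r)%:R * hamming x1 r + (near x2 r)%:R * hamming x2 r
   + (~~ [|| core x0 r, core x1 r | core x2 r])%:R.
  rewrite /center (hammingC r); have p x : 0 <= (near x r)%:R * hamming x r.
    by rewrite mulr_ge0 ?hamming_ge0// ler0n.
  have := p x0; have := p x1; have := p x2.
  have [/core_near->|_] := boolP (core x0 r); first by rewrite /=; lra.
  have [/core_near->|_] := boolP (core x1 r); first by rewrite /=; lra.
  have [/core_near->|_] := boolP (core x2 r); first by rewrite /=; lra.
  by have := hamming_le1 x2 r; rewrite /=; lra.
rewrite /row_error exchange_avg.
have := ler_avg h; rewrite !avgD -/(scatter x0) -/(scatter x1) -/(scatter x2).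
have := avg_uncovered; rewrite /hamming.
have := e0; have := s0; have := s1; have := s2; lra.
Qed.

Local Notation row_weight := (class_weight R row_class).

Lemma row_weight_ge i : 26 / 100 <= row_weight i.
Proof.
have g x : good x -> (forall r, core x r -> row_class r == i) ->
    26 / 100 <= row_weight i.
  move=> gx xi; have := avg_core_ge gx.
  suff : avg (fun r => (core x r)%:R) <= row_weight i by lra.
  apply: ler_avg => r; case: (boolP (core x r)) => [/xi->//|_].
  by rewrite ler0n.
case: i g => -[|[|[|//]]] i3 g;
  [apply: (g x0)|apply: (g x1)|apply: (g x2)] => //;
  move=> r xr; rewrite /row_class.
- by rewrite xr -val_eqE /= inordK.
- have -> : core x0 r = false by apply: core_excl xr; rewrite nearC.
  by rewrite xr -val_eqE /= inordK.
- have -> : core x0 r = false by apply: core_excl xr; rewrite nearC.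
  have -> : core x1 r = false by apply: core_excl xr; rewrite nearC.
  by rewrite -val_eqE /= inordK.
Qed.

(** The complements of N(x0), N(x1), N(x2) ought to partition the columns. *)
Definition bad_col y := (a x0 y + a x1 y + a x2 y != 2)%N.

Lemma good_colE r y : ~~ bad_col y ->
  a (center r) y = (row_class r != col_class y).
Proof.
rewrite /bad_col /center /row_class /col_class.
by case: (core x0 r); case: (core x1 r); case: (a x0 y); case: (a x1 y);
  case: (a x2 y) => //= _; rewrite inord3E.
Qed.

(** After replacing rows by centres, a bad column has degree 1 if all centres
    meet it, and at most 1 - 2 * 0.26 if two of them miss it. Both are at
    distance more than 0.18 from 2/3, so either many cells were changed in the
    column or its true degree is far from 2/3. *)
Lemma bad_col_cost y :
  (bad_col y)%:R <= 12 * row_error y + 125 * (cdeg y - 2 / 3) ^+ 2.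
Proof.
have re0 : 0 <= row_error y by apply: avg_ge0 => r; rewrite ler0n.
have [bad|_] := boolP (bad_col y); last first.
  by rewrite /= addr_ge0// mulr_ge0 ?sqr_ge0// ler0n.
pose t := avg (fun r => (a (center r) y)%:R) : R.
have t1 : cdeg y - row_error y <= t.
  rewrite /cdeg /t -avgN -avgD; apply: ler_avg => r.
  by rewrite /tr; case: (a r y); case: (a _ y) => /=; lra.
have t2 : t <= cdeg y + row_error y.
  rewrite /cdeg /t -avgD; apply: ler_avg => r.
  by rewrite /tr; case: (a r y); case: (a _ y) => /=; lra.
suff h : t = 1 \/ t <= 48 / 100.
  (* Tangent to the parabola where its slope 125 * 2 * 0.048 equals 12. *)
  have := sqr_ge0 (cdeg y - 2 / 3 - 48 / 1000).
  have := sqr_ge0 (cdeg y - 2 / 3 + 48 / 1000).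
  by case: h => h; rewrite /=; lra.
have w2 i j : (i < 3)%N -> (j < 3)%N -> i != j ->
    (forall r, a (center r) y ->
       (row_class r != inord i) && (row_class r != inord j)) -> t <= 48 / 100.
  move=> i3 j3 ij h.
  suff : t <= 1 - row_weight (inord i) - row_weight (inord j).
    have := row_weight_ge (inord i); have := row_weight_ge (inord j).
    by lra.
  rewrite -[X in X - _ - _](avg_cst 1 I0) -!avgN -!avgD; apply: ler_avg => r.
  have := h r; case: (a _ y) => [/(_ isT)/andP[/negbTE-> /negbTE->]|_] /=.
    by lra.
  have [/eqP->|_] := boolP (row_class r == inord i).
    by rewrite inord3E// (negbTE ij) /=; lra.
  by case: (_ == _) => /=; lra.
move: bad; rewrite /bad_col /t; case A: (a x0 y); case B: (a x1 y);
  case C: (a x2 y) => // _.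
- left; rewrite -[RHS](avg_cst 1 I0); apply: eq_avg => r; rewrite /center.
  by case: ifP => _; last case: ifP => _; rewrite ?A ?B ?C.
- right; apply: (w2 1 2)%N => // r; rewrite /center /row_class.
  by case: ifP => _; last case: ifP => _; rewrite ?A ?B ?C ?inord3E.
- right; apply: (w2 0 2)%N => // r; rewrite /center /row_class.
  by case: ifP => _; last case: ifP => _; rewrite ?A ?B ?C ?inord3E.
- right; apply: (w2 0 1)%N => // r; rewrite /center /row_class.
  by case: ifP => _; last case: ifP => _; rewrite ?A ?B ?C ?inord3E.
- right; apply: (w2 0 1)%N => // r; rewrite /center /row_class.
  by case: ifP => _; last case: ifP => _; rewrite ?A ?B ?C ?inord3E.
Qed.

Lemma template_error :
  avg (fun r => avg (fun y => (a r y (+) (row_class r != col_class y))%:R))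
    <= 1000 * 1000 * 2 * e.
Proof.
have h y : avg (fun r => (a r y (+) (row_class r != col_class y))%:R) <=
    13 * row_error y + 125 * (cdeg y - 2 / 3) ^+ 2.
  have := bad_col_cost y; have [_|gy] := boolP (bad_col y) => bc.
    have re0 : 0 <= row_error y by apply: avg_ge0 => r; rewrite ler0n.
    suff : avg (fun r => (a r y (+) (row_class r != col_class y))%:R) <= 1 :> R.
      by move: bc; rewrite /=; lra.
    rewrite -[leRHS](avg_cst 1 I0).
    by apply: ler_avg => r; rewrite lern1 leq_b1.
  rewrite (_ : avg _ = row_error y); first by move: bc; rewrite /=; lra.
  by apply: eq_avg => r; rewrite -good_colE.
rewrite exchange_avg; have := ler_avg h; rewrite avgD !avgZ.
have := avg_row_error; have := cdegV; have := e0; lra.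
Qed.

End Template.

(** The bound on the row weights turns the weighted deviation of the column
    weights into an unweighted one; this shows that the column weights are at
    least 1/4 too, and the argument can be repeated with the roles exchanged. *)
Lemma template_exists : exists (f : I -> 'I_3) (g : J -> 'I_3),
  avg (fun r => avg (fun y => (a r y (+) (f r != g y))%:R))
    <= 1000 * 1000 * 2 * e /\
  \sum_i (class_weight R f i - 1 / 3) ^+ 2 +
    \sum_i (class_weight R g i - 1 / 3) ^+ 2 <= 1000 * 1000 * 40 * e.
Proof.
have [x0 [x1 [x2 [[g0 g1 g2] [s0 s1 s2] [n01 n02 n12]]]]] := three_centers.
have w i : 1 / 4 <= class_weight R (row_class x0 x1) i.
  by have := row_weight_ge g0 g1 g2 n01 n02 n12 i; lra.
have err := template_error g0 g1 g2 s0 s1 s2 n01 n02 n12.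
set f := row_class _ _ in w err; set g := col_class _ _ in err.
exists f, g; split => //.
have err' : avg (fun y => avg (fun r => (tr a y r (+) (g y != f r))%:R))
    <= 1000 * 1000 * 2 * e.
  rewrite exchange_avg; move: err; congr (_ <= _).
  by apply: eq_avg => r; apply: eq_avg => y; rewrite eq_sym.
have rowD := class_weight_dev I0 cdegV err.
have colD := class_weight_dev J0 (a := tr a) degV err'.
have quarter (u q : 'I_3 -> R) : (forall i, 1 / 4 <= u i) ->
    \sum_i u i * (q i - 1 / 3) ^+ 2 <= 2 * (1000 * 1000 * 2 * e) + 2 * e ->
    \sum_i (q i - 1 / 3) ^+ 2 <= 1000 * 1000 * 20 * e.
  clear err err' rowD colD; have := e0.
  move=> e0' u4; have : 1 / 4 * \sum_i (q i - 1 / 3) ^+ 2 <=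
      \sum_i u i * (q i - 1 / 3) ^+ 2.
    by rewrite mulr_sumr ler_sum// => i _; rewrite ler_wpM2r ?sqr_ge0.
  lra.
have {}colD := quarter _ _ w colD.
have wg i : 1 / 4 <= class_weight R g i.
  have h1 : (class_weight R g i - 1 / 3) ^+ 2 <=
      \sum_i (class_weight R g i - 1 / 3) ^+ 2.
    by rewrite (bigD1 i)//= lerDl sumr_ge0// => j _; rewrite sqr_ge0.
  have h2 : (class_weight R g i - 1 / 3) ^+ 2 <= 1 / 1000.
    apply: (le_trans h1); apply: (le_trans colD); have := e_small.
    by clear err err' rowD colD h1; lra.
  clear err err' rowD colD h1.
  by rewrite leNgt; apply/negP => h4; nra.
have {}rowD := quarter _ _ wg rowD.
by clear err err' w wg; lra.
Qed.

End Clusters.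

(** * Stability of the density bound *)

Lemma C3_partner_tr (I J : finType) (a : I -> J -> bool) s :
    C3_partner a s ->
  C3_partner (tr a) (fun p => let q := s (p.2, p.1) in (q.2, q.1)).
Proof.
move=> sP [y x] /= ap; have [aq sq c3] := sP (x, y) ap.
split=> //=; first by rewrite -surjective_pairing sq.
move=> z u zy zq ux uq; have := c3 u z ux uq zy zq; rewrite /tr /=.
by apply: contra => /and5P[-> -> -> -> ->].
Qed.

(** The constant 2500 undoes the factor 51/100/1250 of the bonus. *)
Lemma defect_energy (R : realFieldType) (I J : finType) (a : I -> J -> bool)
    (s : I * J -> I * J) (delta : R) :
    (0 < #|I|)%N -> (0 < #|J|)%N -> C3_partner a s ->
    2 / 3 - avg (rdeg R a) + point_mass R I + point_mass R J <= delta ->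
  avg (fun y => (rdeg R (tr a) y - 2 / 3) ^+ 2) <= 2500 * delta /\
  avg (fun x => avg (defect R a x)) <= 2500 * delta.
Proof.
move=> I0 J0 sP hdelta; have := energy_inequality R I0 J0 sP.
have : 0 <= avg (fun y => (rdeg R (tr a) y - 2 / 3) ^+ 2).
  by apply: avg_ge0 => t; rewrite sqr_ge0.
have : 0 <= avg (fun x => avg (defect R a x)).
  by apply: avg_ge0 => x; apply: avg_ge0 => r; apply: defect_ge0.
by split; lra.
Qed.

Theorem C3_stability (R : realFieldType) (I J : finType) (a : I -> J -> bool)
    (s : I * J -> I * J) (delta : R) :
    (0 < #|I|)%N -> (0 < #|J|)%N -> C3_partner a s ->
    2 / 3 - avg (rdeg R a) + point_mass R I + point_mass R J <= delta ->
    point_mass R J <= delta ->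
    delta <= 1 / 1000 / 1000 / 1000 / 1000 / 1000 / 1000 ->
  exists (f : I -> 'I_3) (g : J -> 'I_3),
    avg (fun r => avg (fun y => (a r y (+) (f r != g y))%:R))
      <= 1000 * 1000 * 1000 * 1000 * delta /\
    \sum_i (class_weight R f i - 1 / 3) ^+ 2 +
      \sum_i (class_weight R g i - 1 / 3) ^+ 2
      <= 1000 * 1000 * 1000 * 1000 * delta.
Proof.
move=> I0 J0 sP hdelta nud delta_small.
have [cV dV] := defect_energy I0 J0 sP hdelta.
have [rV _] : avg (fun x => (rdeg R a x - 2 / 3) ^+ 2) <= 2500 * delta /\
    avg (fun x => avg (defect R (tr a) x)) <= 2500 * delta.
  apply: (defect_energy J0 I0 (C3_partner_tr sP)).
  by rewrite avg_rdeg_tr addrAC.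
have delta0 : 0 <= delta by apply: le_trans nud; apply: point_mass_ge0.
have [|||f [g [err dev]]] :=
  @template_exists R I J a (2500 * delta) I0 J0 _ _ _ cV rV dV.
- by clear - delta0; lra.
- by clear - delta_small; lra.
- by clear - nud delta0; lra.
exists f, g; clear - delta0 err dev; split; lra.
Qed.

(** * Binary matrices and their templates *)

Section Matrices.
Variables (R : realFieldType) (m n : nat).
Implicit Types (A : binmx m n) (P : {set {set 'I_m * 'I_n}}).

Definition entry A (x : 'I_m) (y : 'I_n) : bool := (x, y) \in A.

Definition parts (T : finType) (f : T -> 'I_3) (i : 'I_3) : {set T} :=
  finset (fun t => f t == i).

Lemma tripartition_parts (T : finType) (f : T -> 'I_3) : tripartition (parts f).
Proof.
split=> [i j ij|].
  apply/pred0P => t /=; rewrite !inE; apply: contraNF ij.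
  by move=> /andP[/eqP<- /eqP<-].
apply/setP => t; rewrite finset.in_setT; apply/finset.bigcupP.
by exists (f t); rewrite ?inE.
Qed.

Lemma in_template (f : 'I_m -> 'I_3) (g : 'I_n -> 'I_3) x y :
  ((x, y) \in template (parts f) (parts g)) = (f x != g y).
Proof.
rewrite inE; congr (~~ _); apply/finset.bigcupP/eqP => [[i _]|fg].
  by rewrite !inE /= => /andP[/eqP-> /eqP->].
by exists (f x) => //; rewrite !inE /= fg eqxx.
Qed.

Lemma avg_card (T : finType) (X : {set T}) :
  avg (fun t => (t \in X)%:R) = #|X|%:R / #|T|%:R :> R.
Proof. by rewrite /avg -natr_sum -sum1_card [in RHS]big_mkcond. Qed.

Lemma class_weight_parts (k : nat) (f : 'I_k -> 'I_3) i :
  class_weight R f i = #|parts f i|%:R / k%:R.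
Proof.
rewrite -[X in _ / X%:R](card_ord k) -avg_card; apply: eq_avg => t.
by rewrite inE.
Qed.

Lemma density_entry A :
  avg (rdeg R (entry A)) = #|A|%:R / (m%:R * n%:R).
Proof.
have -> : m%:R * n%:R = #|{: 'I_m * 'I_n}|%:R :> R.
  by rewrite card_prod !card_ord natrM.
by rewrite -avg_card avg_pair.
Qed.

Lemma edit_dist_parts A (f : 'I_m -> 'I_3) (g : 'I_n -> 'I_3) :
  avg (fun x => avg (fun y => (entry A x y (+) (f x != g y))%:R)) =
  (edit_dist A (template (parts f) (parts g)))%:R / (m%:R * n%:R) :> R.
Proof.
have -> : m%:R * n%:R = #|{: 'I_m * 'I_n}|%:R :> R.
  by rewrite card_prod !card_ord natrM.
rewrite /edit_dist -avg_card avg_pair; apply: eq_avg => x; apply: eq_avg => y.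
by rewrite inE in_template /entry; case: (_ \in A); case: (f x == g y).
Qed.

Lemma condC3C A p q : condC3 A p q -> condC3 A q p.
Proof.
move=> c x y xq xp yq yp; have := c x y xp xq yp yq.
case: (_ \notin A) => //=; case: (_ \notin A); case: (_ \notin A) => //=.
by rewrite orbC.
Qed.

(** The partner of p is the other element of its block. *)
Lemma C3_pairing_partner A P : C3_pairing A P ->
  exists s, C3_partner (entry A) s.
Proof.
move=> [/and3P[/eqP cP tP _] pairs].
pose s p := odflt p [pick q in finset.pblock P p | q != p].
exists s => p; rewrite /entry -surjective_pairing => pA.
have Pp : p \in finset.cover P by rewrite cP.
have [u [v [uv bE c3]]] := pairs _ (finset.pblock_mem Pp).
have {u v uv bE c3} [q [pq bE c3]] :
    exists q, [/\ p != q, finset.pblock P p = [set p; q]%SET & condC3 A p q].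
  have : p \in [set u; v]%SET by rewrite -bE finset.mem_pblock.
  rewrite !inE => /orP[] /eqP pE; first by exists v; rewrite pE -bE pE.
  exists u; split; first by rewrite pE eq_sym.
    by rewrite bE pE finset.setUC.
  by rewrite pE; apply: condC3C.
have qp : q \in finset.pblock P p by rewrite bE !inE eqxx orbT.
have sp : s p = q.
  rewrite /s; case: pickP => [z /andP[]|/(_ q)/=]; rewrite bE !inE.
    by move=> /orP[/eqP->|/eqP->//]; rewrite eqxx.
  by rewrite eqxx orbT eq_sym pq.
have qb : finset.pblock P q = finset.pblock P p.
  by apply: finset.def_pblock qp => //; exact: finset.pblock_mem.
have sq : s q = p.
  rewrite /s; case: pickP => [z /andP[]|/(_ p)/=]; rewrite qb bE !inE.
    by move=> /orP[/eqP->//|/eqP->]; rewrite eqxx.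
  by rewrite eqxx pq.
rewrite sp sq; split=> // [|x y x1 x2 y1 y2].
  rewrite -surjective_pairing -cP; apply/finset.bigcupP.
  by exists (finset.pblock P p); rewrite ?finset.pblock_mem.
have := c3 x y x1 x2 y1 y2; by rewrite !negb_and.
Qed.

Lemma matrix_stability A P (eps : R) :
    (0 < m)%N -> (0 < n)%N -> C3_pairing A P -> 0 <= eps ->
    2 / 3 - eps <= #|A|%:R / (m%:R * n%:R) ->
    let delta := eps + 1 / m%:R + 1 / n%:R in
    delta <= 1 / 1000 / 1000 / 1000 / 1000 / 1000 / 1000 ->
  exists (Rs : 'I_3 -> {set 'I_m}) (Cs : 'I_3 -> {set 'I_n}),
    [/\ tripartition Rs, tripartition Cs,
        (edit_dist A (template Rs Cs))%:R
          <= 1000 * 1000 * 1000 * 1000 * delta * m%:R * n%:R &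
        \sum_(i < 3) (#|Rs i|%:R / m%:R - 1 / 3) ^+ 2
          + \sum_(i < 3) (#|Cs i|%:R / n%:R - 1 / 3) ^+ 2
          <= 1000 * 1000 * 1000 * 1000 * delta].
Proof.
move=> m0 n0 AP eps0 dens delta delta_small.
have [s sP] := C3_pairing_partner AP.
have mE : point_mass R 'I_m = 1 / m%:R by rewrite /point_mass card_ord.
have nE : point_mass R 'I_n = 1 / n%:R by rewrite /point_mass card_ord.
have mu0 := point_mass_ge0 R 'I_m; have nu0 := point_mass_ge0 R 'I_n.
have deltaE : delta = eps + point_mass R 'I_m + point_mass R 'I_n.
  by rewrite mE nE.
have [] := @C3_stability R _ _ (entry A) s delta _ _ sP _ _ delta_small.
- by rewrite card_ord.
- by rewrite card_ord.
- by rewrite deltaE density_entry; clear - dens; lra.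
- by rewrite deltaE; clear - eps0 mu0; lra.
move=> f [g []]; rewrite edit_dist_parts => err dev.
exists (parts f), (parts g); split; [exact: tripartition_parts..| |].
  move: err; rewrite ler_pdivrMr ?mulrA//.
  by rewrite mulr_gt0 ?ltr0n.
apply: le_trans dev; rewrite le_eqVlt; apply/orP; left; apply/eqP.
by congr (_ + _); apply: eq_bigr => i _; rewrite class_weight_parts.
Qed.

End Matrices.

(** * Sequences of matrices *)

Section Limit.
Variable K : realType.

Lemma cvg_inv_natr (m : nat -> nat) :
  m k @[k --> \oo] --> \oo -> ((m k)%:R^-1 : K) @[k --> \oo] --> (0 : K).
Proof.
move=> /cvgrnyP moo.
have mK : (m k)%:R @[k --> \oo] --> (+oo%R : set_system K) := moo K.
apply/gtr0_cvgV0 => //.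
by have /cvgryPgt := mK; apply.
Qed.

Lemma sqr_cvg (u d : nat -> K) (l : K) :
    (\forall k \near \oo, (u k - l) ^+ 2 <= d k) -> d @ \oo --> (0 : K) ->
  u @ \oo --> l.
Proof.
move=> ud d0; apply/cvgrPdist_le => e e0.
have e2 : 0 < e ^+ 2 by rewrite exprn_gt0.
near=> k.
have : (u k - l) ^+ 2 <= e ^+ 2.
  apply: (@le_trans _ _ (d k)); first by near: k.
  by near: k; apply: (cvgr_le _ d0).
rewrite distrC -(real_normK (num_real _)).
by rewrite ler_sqr ?nnegrE ?normr_ge0 ?(ltW e0).
Unshelve. all: by end_near.
Qed.


(** The distance of the density from 2/3 serves as epsilon. The templates exist
    only for large k; for the others any partition will do, and one is chosen so
    that the families are total. *)
Lemma limit_stability (m n : nat -> nat) (A : forall k, binmx (m k) (n k))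
    (P : forall k, {set {set 'I_(m k) * 'I_(n k)}}) :
    (forall k, C3_pairing (A k) (P k)) ->
    m k @[k --> \oo] --> \oo ->
    n k @[k --> \oo] --> \oo ->
    (#|A k|%:R / ((m k)%:R * (n k)%:R) : K) @[k --> \oo] --> (2 / 3 : K) ->
  exists (Rs : forall k, 'I_3 -> {set 'I_(m k)})
         (Cs : forall k, 'I_3 -> {set 'I_(n k)}),
    [/\ forall k, tripartition (Rs k) /\ tripartition (Cs k),
        ((edit_dist (A k) (template (Rs k) (Cs k)))%:R
           / ((m k)%:R * (n k)%:R) : K) @[k --> \oo] --> (0 : K) &
        forall i : 'I_3,
          ((#|Rs k i|%:R / (m k)%:R : K) @[k --> \oo] --> (1 / 3 : K)) /\
          ((#|Cs k i|%:R / (n k)%:R : K) @[k --> \oo] --> (1 / 3 : K))].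
Proof.
have d00 : 0 < 1 / 1000 / 1000 / 1000 / 1000 / 1000 / 1000 :> K by lra.
move=> AP moo noo densE.
pose eps k : K := `|#|A k|%:R / ((m k)%:R * (n k)%:R) - 2 / 3|.
pose delta k : K := eps k + 1 / (m k)%:R + 1 / (n k)%:R.
pose C : K := 1000 * 1000 * 1000 * 1000.
have eps_cvg : eps @ \oo --> (0 : K).
  have := cvg_norm (cvgB densE (cvg_cst (2 / 3 : K))).
  by rewrite subrr normr0; apply.
have delta_cvg : delta @ \oo --> (0 : K).
  rewrite -[0 : K]addr0 -[X in X + _]addr0.
  apply: cvgD; first apply: cvgD => //.
    by under eq_fun do rewrite div1r; apply: cvg_inv_natr.
  by under eq_fun do rewrite div1r; apply: cvg_inv_natr.
have Cdelta_cvg : (C * delta k) @[k --> \oo] --> (0 : K).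
  by rewrite -[0 : K](mulr0 C); apply: cvgM => //; apply: cvg_cst.
pose Q k (RC : ('I_3 -> {set 'I_(m k)}) * ('I_3 -> {set 'I_(n k)})) :=
    [/\ tripartition RC.1, tripartition RC.2 &
      (0 < m k)%N -> (0 < n k)%N ->
      delta k <= 1 / 1000 / 1000 / 1000 / 1000 / 1000 / 1000 ->
      (edit_dist (A k) (template RC.1 RC.2))%:R
        <= C * delta k * (m k)%:R * (n k)%:R /\
      \sum_(i < 3) (#|RC.1 i|%:R / (m k)%:R - 1 / 3) ^+ 2
        + \sum_(i < 3) (#|RC.2 i|%:R / (n k)%:R - 1 / 3) ^+ 2 <= C * delta k].
have H k : exists RC, Q k RC.
  have [[[m0 n0] d0]|h] := pselect (((0 < m k)%N /\ (0 < n k)%N) /\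
      delta k <= 1 / 1000 / 1000 / 1000 / 1000 / 1000 / 1000).
    have eps0 : 0 <= eps k by exact: normr_ge0.
    have dens : 2 / 3 - eps k <= #|A k|%:R / ((m k)%:R * (n k)%:R).
      by have := ler_norm (- (#|A k|%:R / ((m k)%:R * (n k)%:R) - 2 / 3) : K);
        rewrite normrN -/(eps k); lra.
    have [Rs [Cs [RT CT ed dev]]] := matrix_stability m0 n0 (AP k) eps0 dens d0.
    by exists (Rs, Cs); split.
  exists (parts (fun=> ord0), parts (fun=> ord0)).
  by split; [exact: tripartition_parts..|move=> m0 n0 d0; case: h].
have [RC RCP] : exists RC : forall k,
    ('I_3 -> {set 'I_(m k)}) * ('I_3 -> {set 'I_(n k)}), forall k, Q k (RC k).
  by exists (fun k => projT1 (cid (H k))) => k; exact: (projT2 (cid (H k))).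
exists (fun k => (RC k).1), (fun k => (RC k).2).
have large : \forall k \near \oo, [/\ (0 < m k)%N, (0 < n k)%N &
    delta k <= 1 / 1000 / 1000 / 1000 / 1000 / 1000 / 1000].
  near=> k; split; near: k.
  - by move/cvgnyPgt: moo; apply.
  - by move/cvgnyPgt: noo; apply.
  - exact: (cvgr_le _ delta_cvg).
have dev (u : nat -> K) : (forall k, (u k - 1 / 3) ^+ 2 <=
    \sum_(i < 3) (#|(RC k).1 i|%:R / (m k)%:R - 1 / 3) ^+ 2
      + \sum_(i < 3) (#|(RC k).2 i|%:R / (n k)%:R - 1 / 3) ^+ 2) ->
    u @ \oo --> (1 / 3 : K).
  move=> uk; apply: sqr_cvg Cdelta_cvg.
  near=> k; apply: le_trans (uk k) _.
  have [m0 n0 d0] : [/\ (0 < m k)%N, (0 < n k)%N &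
    delta k <= 1 / 1000 / 1000 / 1000 / 1000 / 1000 / 1000] by near: k.
  by have [_ _ /(_ m0 n0 d0)[]] := RCP k.
split.
- by move=> k; have [] := RCP k.
- apply: (squeeze_cvgr _ (cvg_cst 0) Cdelta_cvg).
  near=> k; rewrite divr_ge0 ?mulr_ge0 ?ler0n//=.
  have [m0 n0 d0] : [/\ (0 < m k)%N, (0 < n k)%N &
    delta k <= 1 / 1000 / 1000 / 1000 / 1000 / 1000 / 1000] by near: k.
  have [_ _ /(_ m0 n0 d0)[ed _]] := RCP k.
  by rewrite ler_pdivrMr ?mulrA// mulr_gt0 ?ltr0n.
- have sq (T : nat) (F : 'I_T -> K) (i : 'I_T) (z : K) : 0 <= z ->
      F i ^+ 2 <= \sum_j F j ^+ 2 + z.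
    move=> z0; rewrite (bigD1 i)//= -addrA lerDl addr_ge0// sumr_ge0// => j _.
    exact: sqr_ge0.
  move=> i; split; apply: dev => k; last rewrite [leRHS]addrC.
    apply: (sq _ (fun j => #|(RC k).1 j|%:R / (m k)%:R - 1 / 3)).
    by apply: sumr_ge0 => j _; exact: sqr_ge0.
  apply: (sq _ (fun j => #|(RC k).2 j|%:R / (n k)%:R - 1 / 3)).
  by apply: sumr_ge0 => j _; exact: sqr_ge0.
Unshelve. all: by end_near.
Qed.

End Limit.

Theorem theorem5 (K : realType) :
  (exists C delta0 : K, [/\ 0 < C, 0 < delta0 &
    forall (m n : nat) (A : binmx m n)
        (P : {set {set 'I_m * 'I_n}}) (eps : K),
      (0 < m)%N -> (0 < n)%N ->
      C3_pairing A P ->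
      0 <= eps ->
      #|A|%:R / (m%:R * n%:R) >= 2 / 3 - eps ->
      let delta := eps + 1 / m%:R + 1 / n%:R in
      delta <= delta0 ->
      exists (Rs : 'I_3 -> {set 'I_m}) (Cs : 'I_3 -> {set 'I_n}),
        [/\ tripartition Rs, tripartition Cs,
            (edit_dist A (template Rs Cs))%:R <= C * delta * m%:R * n%:R &
            \sum_(i < 3) (#|Rs i|%:R / m%:R - 1 / 3) ^+ 2
              + \sum_(i < 3) (#|Cs i|%:R / n%:R - 1 / 3) ^+ 2
              <= C * delta]]) /\
  (forall (m n : nat -> nat) (A : forall k, binmx (m k) (n k))
      (P : forall k, {set {set 'I_(m k) * 'I_(n k)}}),
    (forall k, C3_pairing (A k) (P k)) ->
    m k @[k --> \oo] --> \oo ->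
    n k @[k --> \oo] --> \oo ->
    (#|A k|%:R / ((m k)%:R * (n k)%:R) : K) @[k --> \oo] --> (2 / 3 : K) ->
    exists (Rs : forall k, 'I_3 -> {set 'I_(m k)})
           (Cs : forall k, 'I_3 -> {set 'I_(n k)}),
      [/\ forall k, tripartition (Rs k) /\ tripartition (Cs k),
          ((edit_dist (A k) (template (Rs k) (Cs k)))%:R
             / ((m k)%:R * (n k)%:R) : K) @[k --> \oo] --> (0 : K) &
          forall i : 'I_3,
            ((#|Rs k i|%:R / (m k)%:R : K) @[k --> \oo] --> (1 / 3 : K)) /\
            ((#|Cs k i|%:R / (n k)%:R : K) @[k --> \oo] --> (1 / 3 : K))]).
Proof.
split; last by move=> m n A P; exact: limit_stability.
exists (1000 * 1000 * 1000 * 1000).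
exists (1 / 1000 / 1000 / 1000 / 1000 / 1000 / 1000).
split; [lra|lra|].
by move=> m n A P eps; exact: matrix_stability.
Qed.
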